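(* Let $(C_n)$ be a family of circuits of depth $d=d(n)$, where $C_n$ computes $\mathrm{CLIQUE}$ on $n$-vertex graphs, and suppose that for each gate $g$ of $C_n$ the function computed at $g$ has an orientation $\beta_g$ such that the number of vertices of the input graph that are endpoints of edges $e$ with $(\beta_g)_e=1$ is at most $w=w(n)$. Then $d\cdot w=\Omega(n/\log n)$.
   Context: Circuits have $\land,\lor$ gates of fan-in at most two and $\neg$ gates. Input variables are indexed by edges $e=\{u,v\}$ of the complete graph on $n$ vertices. A Boolean function $f:\{0,1\}^N\to\{0,1\}$ has orientation $\beta\in\{0,1\}^N$ if there is a monotone $h$ with $f(x)=h(x,x\oplus\beta)$ for all $x$. $\mathrm{CLIQUE}=\mathrm{CLIQUE}(n,n/2)$ is $1$ iff the input graph has a clique of size $n/2$.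
   Formalization: The formal theorem additionally assumes w(n) ≥ 1 for all n: with w(n) = 0 the claim fails, since CLIQUE has a monotone circuit whose gates all have orientation 0, giving d·w = 0. *)

(* Defs.v *)
From mathcomp Require Import all_boot.

Set Implicit Arguments.
Unset Strict Implicit.
Unset Printing Implicit Defensive.

Definition monotone (I : finType) (h : {ffun I -> bool} -> bool) : Prop :=
  forall x y : {ffun I -> bool}, (forall i, x i ==> y i) -> h x ==> h y.

Section Orientation.
Variable I : finType.

(* The string (x, x \oplus beta) of length 2N, indexed by I + I. *)
Definition oriented_input (beta x : {ffun I -> bool}) : {ffun I + I -> bool} :=
  [ffun s => match s with inl i => x i | inr i => x i (+) beta i end].

Definition has_orientation (f : {ffun I -> bool} -> bool)
    (beta : {ffun I -> bool}) : Prop :=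
  exists2 h : {ffun I + I -> bool} -> bool,
    monotone h & forall x, f x = h (oriented_input beta x).

End Orientation.

Section Circuits.
Variable I : finType.

(* A circuit is a directed acyclic graph whose nodes are listed in a
   topological order; the natural numbers are positions in that list. *)
Inductive gate : Type :=
  | Var of I
  | Not of nat
  | And of seq nat
  | Or of seq nat.

Definition gate_args (g : gate) : seq nat :=
  match g with
  | Var _ => [::]
  | Not j => [:: j]
  | And js => js
  | Or js => js
  end.

(* Fan-in 0 is allowed: And [::] and Or [::] are the constants 1 and 0. *)
Record circuit : Type := Circuit {
  gates : seq gate;
  output : nat;
  gates_acyclic : forall k g, onth gates k = Some g ->
    all (fun j => j < k) (gate_args g);
  gates_fanin : forall k g, onth gates k = Some g -> size (gate_args g) <= 2;
  output_lt : output < size gates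
}.

(* Lists, for each gate in order, the value that step computes from the values
   of the earlier gates. *)
Definition scan_gates (A : Type) (step : seq A -> gate -> A)
    (gs : seq gate) : seq A :=
  foldl (fun vs g => rcons vs (step vs g)) [::] gs.

Definition gate_value (x : {ffun I -> bool}) (vs : seq bool) (g : gate) : bool :=
  match g with
  | Var i => x i
  | Not j => ~~ nth false vs j
  | And js => all (nth false vs) js
  | Or js => has (nth false vs) js
  end.

Definition gate_fun (C : circuit) (k : nat) (x : {ffun I -> bool}) : bool :=
  nth false (scan_gates (gate_value x) (gates C)) k.

(* Number of edges on a longest path ending at the gate; negations count. *)
Definition gate_level (ls : seq nat) (g : gate) : nat :=
  \max_(j <- gate_args g) (nth 0 ls j).+1.

Definition depth (C : circuit) : nat :=
  nth 0 (scan_gates gate_level (gates C)) (output C).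

Definition computes (C : circuit) (f : {ffun I -> bool} -> bool) : Prop :=
  forall x, gate_fun C (output C) x = f x.

End Circuits.

Notation edge n := {e : {set 'I_n} | #|e| == 2%N}.

Definition is_clique (n : nat) (x : {ffun edge n -> bool})
    (S : {set 'I_n}) : bool :=
  [forall e : edge n, (val e \subset S) ==> x e].

Definition CLIQUE (n k : nat) (x : {ffun edge n -> bool}) : bool :=
  [exists S : {set 'I_n}, (#|S| == k) && is_clique x S].

Definition touched (n : nat) (beta : {ffun edge n -> bool}) : {set 'I_n} :=
  [set v | [exists e : edge n, beta e && (v \in val e)]].

(* Main.v *)
Require Import Defs.
From mathcomp Require Import all_boot all_order all_algebra all_fingroup zify.

(** Alice holds an [n/2]-clique, Bob a graph without one, and they look for an
edge of the clique missing from Bob's graph by walking down the circuit.  At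
each gate Alice announces the trace of her clique on the (at most [2 w])
vertices touched by the orientations of the arguments; if this does not expose
a missing edge, Bob lowers his graph to agree with Alice's on the possibly
non-monotone edges, which keeps the gate at [0].  A negation gate is then never
reached with differing values.  So the pairs of inputs are covered by
[2 ^ (6 w d)] rectangles, each with a common answer.

The number of such rectangles is bounded below by the rank method.  Take the
Tseitin equations on a bounded-degree expander with [2 J + 1] nodes, each edge
variable [z_e] being split as [y_e (x_e)] with [x_e] known to Alice and the
function [y_e] to Bob; an unsatisfiable system with bounded local views embeds
in the clique game on linearly many vertices.  With [w_v = -1] iff the equation
at [v] fails, the function [chi_E * \sum_(#|A| <= J) \prod_(v in A) w_v] gives a
matrix of full rank [s ^ #|E|], whereas wherever [w_v = -1] the sum telescopes
to the layer [#|A| = J], whose terms are characters missing the edge boundary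
of [A], and the rank drops exponentially. *)

Set Implicit Arguments.
Unset Strict Implicit.
Unset Printing Implicit Defensive.

Import GRing.Theory Num.Theory.

(** * The communication game of a sparsely oriented circuit *)

Section ScanGates.
Variables (I : finType) (A : Type) (step : seq A -> gate I -> A) (a0 : A).

Lemma scan_gates_rcons gs g :
  scan_gates step (rcons gs g) =
  rcons (scan_gates step gs) (step (scan_gates step gs) g).
Proof. by rewrite /scan_gates foldl_rcons. Qed.

Lemma size_scan_gates gs : size (scan_gates step gs) = size gs.
Proof.
elim/last_ind: gs => // gs g IH.
by rewrite scan_gates_rcons !size_rcons IH.
Qed.

Lemma nth_scan_gates gs k g : onth gs k = Some g ->
  nth a0 (scan_gates step gs) k = step (take k (scan_gates step gs)) g.
Proof.
elim/last_ind: gs => [|gs h IH]; first by rewrite onthE; case: k.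
rewrite scan_gates_rcons.
have [ltk|] := ltnP k (size gs).
  rewrite onthE map_rcons nth_rcons size_map ltk -onthE => /IH.
  rewrite nth_rcons size_scan_gates ltk => ->.
  by rewrite -cats1 takel_cat // size_scan_gates ltnW.
rewrite leq_eqVlt => /orP[/eqP <-|ltk].
  rewrite onthE map_rcons nth_rcons size_map ltnn eqxx => -[->].
  rewrite nth_rcons size_scan_gates ltnn eqxx -cats1.
  by rewrite -(size_scan_gates gs) take_size_cat.
rewrite onthE map_rcons nth_default // size_rcons size_map; lia.
Qed.

End ScanGates.

Section GateFun.
Variables (I : finType) (C : circuit I).

Definition gate_depth (k : nat) : nat :=
  nth 0 (scan_gates (@gate_level I) (gates C)) k.

Lemma nth_take_arg (T : Type) (x0 : T) (s : seq T) k g j :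
  onth (gates C) k = Some g -> j \in gate_args g ->
  nth x0 (take k s) j = nth x0 s j.
Proof. by move=> /gates_acyclic /allP + /[dup] jg => /[apply] ltj; rewrite nth_take. Qed.

Lemma gate_funE k g x : onth (gates C) k = Some g ->
  gate_fun C k x = match g with
  | Var i => x i
  | Not j => ~~ gate_fun C j x
  | And js => all (fun j => gate_fun C j x) js
  | Or js => has (fun j => gate_fun C j x) js
  end.
Proof.
move=> gk; rewrite /gate_fun (nth_scan_gates _ _ gk).
case: g gk => //= [j|js|js] gk.
- by rewrite (nth_take_arg _ _ gk) //= mem_head.
- by apply: eq_in_all => j jjs; apply: (nth_take_arg _ _ gk).
- by apply: eq_in_has => j jjs; apply: (nth_take_arg _ _ gk).
Qed.

Lemma gate_depth_arg k g j : onth (gates C) k = Some g -> j \in gate_args g ->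
  gate_depth j < gate_depth k.
Proof.
move=> gk jg; rewrite {2}/gate_depth (nth_scan_gates _ _ gk) /gate_level.
rewrite (big_rem j) //= (nth_take_arg _ _ gk) // leq_max.
by rewrite leqnn.
Qed.

End GateFun.

(** Where [beta] is set, [x] and [y] agree; elsewhere the second half of the oriented input is [x]
    again. So the whole oriented input grows. *)
Lemma has_orientation_homo (I : finType) (f : {ffun I -> bool} -> bool) beta
    (x y : {ffun I -> bool}) :
  has_orientation f beta -> (forall i, beta i -> x i = y i) ->
  (forall i, x i ==> y i) -> f x -> f y.
Proof.
move=> [h h_mono fE] eq_xy le_xy; rewrite !fE; apply/implyP/h_mono => -[i|i].
  by rewrite !ffunE.
rewrite !ffunE; case bi: (beta i); last by rewrite !addbF.
by rewrite eq_xy // implybb.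
Qed.

(** Subadditivity under a message of either player. It replaces the counting of rectangles and is
    instantiated by matrix rank in [rect_rank_measure]. *)
Record rect_measure (X Y : finType) (mu : {set X} -> {set Y} -> nat) : Prop := {
  rect_measure0l : forall B, mu set0 B = 0;
  rect_measure0r : forall A, mu A set0 = 0;
  rect_measurel : forall (J : finType) (D : {set J}) (h : X -> J) (A : {set X}) B,
    {in A, forall x, h x \in D} ->
    mu A B <= \sum_(j in D) mu [set x in A | h x == j] B;
  rect_measurer : forall (J : finType) (D : {set J}) (h : Y -> J) A (B : {set Y}),
    {in B, forall y, h y \in D} ->
    mu A B <= \sum_(j in D) mu A [set y in B | h y == j]
}.

Definition clique_graph n (S : {set 'I_n}) : {ffun edge n -> bool} :=
  [ffun e : edge n => val e \subset S].

Section SparseProtocol.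
Variables (n : nat) (C : circuit (edge n)) (w r : nat).
Hypothesis w_gt0 : 0 < w.
Hypothesis sparse : forall k, k < size (gates C) ->
  exists2 beta : {ffun edge n -> bool},
    has_orientation (gate_fun C k) beta & #|touched beta| <= w.
Variables (X Y : finType) (mu : {set X} -> {set Y} -> nat).
Variables (S : X -> {set 'I_n}) (G : Y -> {ffun edge n -> bool}).
Hypothesis mu_rect : rect_measure mu.
Hypothesis mu_edge : forall (e : edge n) (A : {set X}) (B : {set Y}),
  {in A, forall x, val e \subset S x} -> {in B, forall y, ~~ G y e} ->
  mu A B <= r.

(* [H y] is Bob's graph [G y] lowered so as to agree
   with Alice's clique wherever the gate may be non-monotone. *)
Definition game_state (k : nat) (beta : {ffun edge n -> bool})
    (A : {set X}) (B : {set Y}) (H : Y -> {ffun edge n -> bool}) : Prop :=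
  [/\ {in A, forall x, gate_fun C k (clique_graph (S x))},
      {in B, forall y, ~~ gate_fun C k (H y)},
      {in A & B, forall x y (e : edge n), beta e -> (val e \subset S x) = H y e} &
      {in A & B, forall x y (e : edge n), val e \subset S x -> ~~ H y e -> ~~ G y e}].

Lemma game_state_subset k beta (A A' : {set X}) (B B' : {set Y}) H :
  A' \subset A -> B' \subset B -> game_state k beta A B H -> game_state k beta A' B' H.
Proof.
move=> /subsetP sA /subsetP sB [h1 h2 h3 h4]; split.
- by move=> x /sA /h1.
- by move=> y /sB /h2.
- by move=> x y /sA xA /sB yB; apply: h3.
- by move=> x y /sA xA /sB yB; apply: h4.
Qed.

Lemma edge_touched (beta : {ffun edge n -> bool}) (e : edge n) :
  beta e -> val e \subset touched beta.
Proof.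
by move=> be; apply/subsetP => v ve; rewrite inE; apply/existsP; exists e; rewrite be.
Qed.

(* Bob adopts Alice's values on the edges of [gam], which he learns from
   [U], the trace of Alice's clique on the touched vertices. *)
Definition lower (gam : {ffun edge n -> bool}) (U : {set 'I_n})
    (H : Y -> {ffun edge n -> bool}) (y : Y) : {ffun edge n -> bool} :=
  [ffun e : edge n => if gam e then val e \subset U else H y e].

(** One round: Alice sends her trace on [touched gam]; Bob either names an edge of [gam] that she
    has and [H] lacks, at cost [r], or reports none and lowers [H]. *)
Lemma mu_step k beta (gam : {ffun edge n -> bool}) (q : nat) A B H :
  has_orientation (gate_fun C k) beta ->
  game_state k beta A B H -> #|touched gam| <= w.*2 ->
  (forall (A' : {set X}) (B' : {set Y}) H',
      game_state k beta A' B' H' ->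
      {in A' & B', forall x y (e : edge n), gam e -> (val e \subset S x) = H' y e} ->
      mu A' B' <= q) ->
  mu A B <= 2 ^ w.*2 * (2 ^ w.*2 * r + q).
Proof.
move=> bk st cardT IH; set T := touched gam.
have cardP : #|powerset T| <= 2 ^ w.*2 by rewrite card_powerset leq_exp2l.
apply: (leq_trans (rect_measurel mu_rect (D := powerset T) (h := fun x => S x :&: T) _ _)).
  by move=> x _; rewrite inE subsetIr.
have bound U : U \in powerset T ->
    mu [set x in A | S x :&: T == U] B <= 2 ^ w.*2 * r + q.
  rewrite inE => UT; set A' := [set x in A | _].
  have [->|[x0 x0A]] := set_0Vmem A'; first by rewrite (rect_measure0l mu_rect).
  have A'A : A' \subset A by apply/subsetP => x; rewrite inE => /andP[].
  have {}st := game_state_subset A'A (subxx B) st.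
  have SU x (e : edge n) : x \in A' -> gam e -> (val e \subset S x) = (val e \subset U).
    rewrite inE => /andP[_ /eqP <-] /edge_touched eT.
    by rewrite subsetI eT andbT.
  pose h y := [pick e : edge n | [&& gam e, val e \subset U & ~~ H y e]].
  pose D : {set option (edge n)} := None |: [set Some e | e : edge n & val e \subset T].
  apply: (leq_trans (rect_measurer mu_rect (D := D) (h := h) _ _)).
    move=> y _; rewrite /h /D !inE; case: pickP => [e /and3P[ge eU _]|_] //.
    by apply/orP; right; apply/imsetP; exists e => //; rewrite inE (edge_touched ge).
  rewrite (big_setU1 None) /=; last first.
    by apply/imsetP => -[e _].
  rewrite addnC leq_add //.
    rewrite big_imset /=; last by move=> e e' _ _ [].
    apply: (@leq_trans (\sum_(e in [set e : edge n | val e \subset T]) r)).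
      apply: leq_sum => e; rewrite inE => eT; set B' := [set y in B | _].
      have [->|[y0]] := set_0Vmem B'; first by rewrite (rect_measure0r mu_rect).
      have hE y : y \in B' -> [&& gam e, val e \subset U & ~~ H y e].
        by rewrite inE /h; case: pickP => [e' + /andP[_ /eqP[<-]]|_ /andP[_ /eqP]].
      move=> /hE /and3P[ge eU _]; apply: (@mu_edge e).
        by move=> x xA'; rewrite SU.
      move=> y yB'; have /and3P[_ _ Hye] := hE y yB'.
      case: st => _ _ _ /(_ x0 y x0A); apply=> //; last by rewrite SU.
      by move: yB'; rewrite inE => /andP[].
    (* Edges inside [T] are themselves subsets of [T]. *)
    rewrite sum_nat_const leq_mul2r; apply/orP; right.
    apply: leq_trans cardP; rewrite -(card_imset _ val_inj) subset_leq_card //.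
    by apply/subsetP => _ /imsetP[e + ->]; rewrite !inE.
  set B' := [set y in B | _].
  have B'B : B' \subset B by apply/subsetP => y; rewrite inE => /andP[].
  have {}st := game_state_subset (subxx A') B'B st.
  have HU y (e : edge n) : y \in B' -> gam e -> val e \subset U -> H y e.
    rewrite inE /h; case: pickP => [e' _ /andP[_ /eqP]//|+ _ ge eU] => /(_ e).
    by rewrite ge eU /= => /negbFE.
  case: st => fS fH eqb ltG.
  apply: (IH _ _ (lower gam U H)); last first.
    by move=> x y xA' yB' e ge; rewrite ffunE ge SU.
  split=> //.
  (* On [beta] both sides already agreed, so lowering changes nothing there; elsewhere it only
     removes edges, so the gate stays at 0. *)
  - move=> y yB'; apply: contra (fH y yB'); apply: (has_orientation_homo bk).
      move=> e be; rewrite ffunE; case: ifP => // ge.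
      by rewrite -(SU x0) // (eqb x0 y).
    move=> e; rewrite ffunE; case: ifP => [ge|_]; last exact: implybb.
    by apply/implyP; apply: HU.
  - move=> x y xA' yB' e be; rewrite ffunE; case: ifP => ge; last exact: eqb.
    exact: SU.
  - move=> x y xA' yB' e eS; rewrite ffunE; case: ifP => ge; last exact: (ltG x y).
    by rewrite -(SU x) // eS.
apply: (@leq_trans (\sum_(U in powerset T) (2 ^ w.*2 * r + q))).
  exact: leq_sum.
by rewrite sum_nat_const leq_mul2r cardP orbT.
Qed.

Definition args_union (js : seq nat) (b : nat -> {ffun edge n -> bool}) :
  {ffun edge n -> bool} := [ffun e : edge n => has (fun j => b j e) js].

Lemma card_touched_union (b : nat -> {ffun edge n -> bool}) js :
  size js <= 2 -> {in js, forall j, #|touched (b j)| <= w} ->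
  #|touched (args_union js b)| <= w.*2.
Proof.
move=> js2 bw.
have : #|touched (args_union js b)| <= \sum_(j <- js) #|touched (b j)|.
  apply: (@leq_trans #|\bigcup_(j <- js) touched (b j)|).
    apply/subset_leq_card/subsetP => v; rewrite inE => /existsP[e].
    rewrite ffunE => /andP[/hasP[j jjs be] ve].
    rewrite (big_rem j) //= inE; apply/orP; left.
    by rewrite inE; apply/existsP; exists e; rewrite be.
  elim: js {js2 bw} => [|j js IH]; first by rewrite !big_nil cards0.
  rewrite !big_cons (leq_trans (leq_card_setU _ _)) // leq_add2l //.
move=> /leq_trans; apply.
apply: (@leq_trans (\sum_(j <- js) w)).
  by rewrite big_seq [X in _ <= X]big_seq leq_sum.
by rewrite big_const_seq count_predT iter_addn_0 -muln2 leq_mul2l js2 orbT.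
Qed.

Lemma mu_splitr (q : nat) (A : {set X}) (B : {set Y}) (p : pred Y) :
  mu A [set y in B | p y] <= q -> mu A [set y in B | ~~ p y] <= q -> mu A B <= q.*2.
Proof.
move=> h1 h2.
apply: (leq_trans (rect_measurer mu_rect (D := [set true; false]) (h := p) _ _)).
  by move=> y _; rewrite !inE; case: (p y).
rewrite big_setU1 ?inE // big_set1 -addnn leq_add //.
  rewrite (_ : [set _ in B | _] = [set y in B | p y]) //.
  by apply/setP => y; rewrite !inE eqb_id.
rewrite (_ : [set _ in B | _] = [set y in B | ~~ p y]) //.
by apply/setP => y; rewrite !inE eqbF_neg.
Qed.

Lemma mu_splitl (q : nat) (A : {set X}) (B : {set Y}) (p : pred X) :
  mu [set x in A | p x] B <= q -> mu [set x in A | ~~ p x] B <= q -> mu A B <= q.*2.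
Proof.
move=> h1 h2.
apply: (leq_trans (rect_measurel mu_rect (D := [set true; false]) (h := p) _ _)).
  by move=> y _; rewrite !inE; case: (p y).
rewrite big_setU1 ?inE // big_set1 -addnn leq_add //.
  rewrite (_ : [set _ in A | _] = [set x in A | p x]) //.
  by apply/setP => x; rewrite !inE eqb_id.
rewrite (_ : [set _ in A | _] = [set x in A | ~~ p x]) //.
by apply/setP => x; rewrite !inE eqbF_neg.
Qed.

Lemma sparse_choice : exists b : nat -> {ffun edge n -> bool},
  forall j, j < size (gates C) ->
    has_orientation (gate_fun C j) (b j) /\ #|touched (b j)| <= w.
Proof.
have /fin_all_exists[b bP] : forall j : 'I_(size (gates C)),
    exists beta, has_orientation (gate_fun C j) beta /\ #|touched beta| <= w.
  by move=> j; have [beta] := sparse (ltn_ord j); exists beta.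
exists (fun j => oapp b [ffun=> false] (insub j)) => j ltj.
by rewrite insubT /=; apply: (bP (Ordinal ltj)).
Qed.

Lemma mu_not_gate k beta j beta' A B H :
  onth (gates C) k = Some (Not _ j) ->
  has_orientation (gate_fun C k) beta -> has_orientation (gate_fun C j) beta' ->
  game_state k beta A B H ->
  {in A & B, forall x y (e : edge n), beta' e -> (val e \subset S x) = H y e} ->
  mu A B = 0.
Proof.
move=> gk bk bj [fS fH eqb _] eqb'.
have [->|[x xA]] := set_0Vmem A; first exact: rect_measure0l mu_rect _.
have [->|[y yB]] := set_0Vmem B; first exact: rect_measure0r mu_rect _.
(* [~~ gate_fun j] rises from Alice's graph to the join, [gate_fun j] rises
   from Bob's graph to the join. *)
pose u : {ffun edge n -> bool} := [ffun e : edge n => clique_graph (S x) e || H y e].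
have fku : gate_fun C k u.
  apply: (has_orientation_homo bk) (fS x xA) => e; rewrite !ffunE; last first.
    by case: (val e \subset S x).
  by move=> be; rewrite (eqb x y) // orbb.
have fju : gate_fun C j u.
  apply: (has_orientation_homo bj (x := H y)); last first.
  - by have := fH y yB; rewrite (gate_funE _ gk) negbK.
  - by move=> e; rewrite !ffunE; case: (H y e); rewrite ?orbT.
  by move=> e be; rewrite !ffunE (eqb' x y) // orbb.
by move: fku; rewrite (gate_funE _ gk) fju.
Qed.

(** Induction down the circuit: at [And] Bob names an argument with value 0, at [Or] Alice names one
    with value 1, and at [Var] the input edge is the answer. *)
Lemma mu_gate k beta A B H : k < size (gates C) ->
  has_orientation (gate_fun C k) beta -> game_state k beta A B H ->
  mu A B <= r * (2 ^ (6 * w)) ^ gate_depth C k.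
Proof.
have [b bP] := sparse_choice.
elim/ltn_ind: k beta A B H => k IHk beta A B H ltk bk st.
case gk: (onth (gates C) k) => [g|]; last by move: ltk; rewrite -onthTE gk.
have argsP := gates_acyclic gk; have fan := gates_fanin gk.
have arg_lt j : j \in gate_args g -> j < k by move/(allP argsP).
have arg_size j : j \in gate_args g -> j < size (gates C).
  by move=> /arg_lt /ltn_trans; apply.
have [->|[x0 x0A]] := set_0Vmem A; first by rewrite (rect_measure0l mu_rect).
have [->|[y0 y0B]] := set_0Vmem B; first by rewrite (rect_measure0r mu_rect).
set q := r * (2 ^ (6 * w)) ^ (gate_depth C k).-1.
have step : 0 < size (gate_args g) ->
    (forall (A' : {set X}) (B' : {set Y}) H', game_state k beta A' B' H' ->
      {in gate_args g, forall j, {in A' & B', forall x y (e : edge n),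
        b j e -> (val e \subset S x) = H' y e}} ->
      mu A' B' <= q.*2) ->
    mu A B <= r * (2 ^ (6 * w)) ^ gate_depth C k.
  move=> args0 bound.
  have dk : 0 < gate_depth C k.
    case: (gate_args g) args0 (fun j => @gate_depth_arg _ C k g j gk) => // j js _.
    by move=> /(_ j (mem_head _ _)); case: (gate_depth C k).
  apply: (@leq_trans (2 ^ w.*2 * (2 ^ w.*2 * r + q.*2))).
    apply: (mu_step bk st (card_touched_union (b := b) fan _)).
      by move=> j /arg_size /bP[].
    move=> A' B' H' st' eqb; apply: (bound _ _ _ st') => j jg x y xA yB e be.
    by apply: eqb => //; rewrite ffunE; apply/hasP; exists j.
  rewrite -(prednK dk) expnS mulnCA -/q.
  have -> : 6 * w = w.*2 + w.*2 + w.*2 by lia.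
  have rq : r <= q by rewrite leq_pmulr // expn_gt0 expn_gt0.
  rewrite !expnD -!mulnA leq_mul2l; apply/orP; right.
  (* With [a = 2 ^ w.*2] the round costs a factor [a * (a + 2) <= a ^ 3 = 2 ^ (6 * w)]. *)
  have : 4 <= 2 ^ w.*2 by rewrite (@leq_exp2l 2 2) // -(doubleS 0) leq_double.
  move: (2 ^ _) => a a4; apply: (@leq_trans ((a + 2) * q)).
    by rewrite mulnDl mul2n leq_add2r leq_mul2l rq orbT.
  by rewrite mulnA leq_mul2r; apply/orP; right; nia.
have arg_bound j (A' : {set X}) (B' : {set Y}) H' : j \in gate_args g ->
    game_state k beta A' B' H' ->
    {in A' & B', forall x y (e : edge n), b j e -> (val e \subset S x) = H' y e} ->
    {in A', forall x, gate_fun C j (clique_graph (S x))} ->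
    {in B', forall y, ~~ gate_fun C j (H' y)} -> mu A' B' <= q.
  move=> jg [_ _ _ ltG] eqb fS fH.
  have [bj _] := bP j (arg_size j jg).
  apply: (leq_trans (IHk j (arg_lt j jg) (b j) A' B' H' (arg_size j jg) bj _)).
    by split.
  rewrite /q leq_mul2l leq_exp2l; last by rewrite -(expn0 2) ltn_exp2l // muln_gt0.
  by apply/orP; right; have := gate_depth_arg gk jg; lia.
have sub2 (A' : {set X}) (p : pred X) : [set x in A' | p x] \subset A'.
  by apply/subsetP => x; rewrite inE => /andP[].
have sub2' (B' : {set Y}) (p : pred Y) : [set y in B' | p y] \subset B'.
  by apply/subsetP => x; rewrite inE => /andP[].
have fE x : gate_fun C k x = _ := gate_funE x gk.
case: g gk {argsP} fan arg_lt arg_size step arg_bound fE => [i|j|js|js] gk /= fan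
    arg_lt arg_size step arg_bound fE.
- case: st => fS fH _ ltG.
  apply: (@leq_trans r); last by rewrite leq_pmulr // expn_gt0 expn_gt0.
  apply: (@mu_edge i).
    by move=> x /fS; rewrite fE ffunE.
  move=> y yB; apply: (ltG x0 y) => //; last by have := fH y yB; rewrite fE.
  by have := fS x0 x0A; rewrite fE ffunE.
- apply: step => // A' B' H' st' eqb.
  have [bj _] := bP j (arg_size j (mem_head _ _)).
  by rewrite (mu_not_gate gk bk bj st') //; apply: eqb; apply: mem_head.
- case: js gk fan arg_lt arg_size step arg_bound fE => [|j1 js] gk fan arg_lt
    arg_size step arg_bound fE.
    (* The empty conjunction is constantly 1, so it cannot be 0 on Bob's side. *)
    by case: st => _ /(_ y0 y0B); rewrite fE.
  apply: step => // A' B' H' st' eqb.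
  case: (st') => fS fH _ _.
  apply: (@mu_splitr _ _ _ (fun y => ~~ gate_fun C j1 (H' y))).
    apply: (arg_bound j1 _ _ _ (mem_head _ _) (game_state_subset (subxx A') (sub2' _ _) st')).
    - by move=> x y xA; rewrite inE => /andP[yB _]; apply: eqb; rewrite ?mem_head.
    - by move=> x /fS; rewrite fE => /andP[].
    - by move=> y; rewrite inE => /andP[].
  case: js gk fan arg_lt arg_size arg_bound fE eqb => [|j2 [|//]] gk fan arg_lt
      arg_size arg_bound fE eqb.
    rewrite (_ : [set _ in _ | _] = set0) ?(rect_measure0r mu_rect) //.
    apply/setP => y; rewrite !inE negbK; apply/negbTE/negP => /andP[/fH].
    by rewrite fE /= andbT => /negP.
  have j2g : j2 \in [:: j1; j2] by rewrite !inE eqxx orbT.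
  apply: (arg_bound j2 _ _ _ j2g (game_state_subset (subxx A') (sub2' _ _) st')).
  - by move=> x y xA; rewrite inE => /andP[yB _]; apply: eqb.
  - by move=> x /fS; rewrite fE => /and3P[].
  - move=> y; rewrite inE negbK => /andP[/fH]; rewrite fE /= andbT negb_and.
    by case/orP=> [/negbTE ->|].
- case: js gk fan arg_lt arg_size step arg_bound fE => [|j1 js] gk fan arg_lt
    arg_size step arg_bound fE.
    by case: st => /(_ x0 x0A); rewrite fE.
  apply: step => // A' B' H' st' eqb.
  case: (st') => fS fH _ _.
  apply: (@mu_splitl _ _ _ (fun x => gate_fun C j1 (clique_graph (S x)))).
    apply: (arg_bound j1 _ _ _ (mem_head _ _) (game_state_subset (sub2 _ _) (subxx B') st')).
    - by move=> x y; rewrite inE => /andP[xA _] yB; apply: eqb; rewrite ?mem_head.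
    - by move=> x; rewrite inE => /andP[].
    - by move=> y /fH; rewrite fE /= negb_or => /andP[].
  case: js gk fan arg_lt arg_size arg_bound fE eqb => [|j2 [|//]] gk fan arg_lt
      arg_size arg_bound fE eqb.
    rewrite (_ : [set _ in _ | _] = set0) ?(rect_measure0l mu_rect) //.
    apply/setP => x; rewrite !inE; apply/negbTE/negP => /andP[/fS].
    by rewrite fE /= orbF => ->.
  have j2g : j2 \in [:: j1; j2] by rewrite !inE eqxx orbT.
  apply: (arg_bound j2 _ _ _ j2g (game_state_subset (sub2 _ _) (subxx B') st')).
  - by move=> x y; rewrite inE => /andP[xA _] yB; apply: eqb.
  - by move=> x; rewrite inE => /andP[/fS]; rewrite fE /= orbF => /orP[->|].
  - by move=> y /fH; rewrite fE /= orbF negb_or => /andP[].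
Qed.

End SparseProtocol.

(** * Unsatisfiable constraint systems inside CLIQUE *)

Lemma CLIQUE_homo n k (x y : {ffun edge n -> bool}) :
  (forall e, x e ==> y e) -> @CLIQUE n k x -> @CLIQUE n k y.
Proof.
move=> le_xy /existsP[S /andP[cS /forallP xS]]; apply/existsP; exists S.
rewrite cS; apply/forallP => e; apply/implyP => eS.
by apply: (implyP (le_xy e)); apply: (implyP (xS e)).
Qed.

(** The zero orientation makes the agreement clause of [game_state] vacuous, so the game can start
    at the output. *)
Lemma CLIQUE_orientation n k : has_orientation (@CLIQUE n k) [ffun=> false].
Proof.
exists (fun u => @CLIQUE n k [ffun e => u (inl e)]).
  move=> u v le_uv; apply/implyP/CLIQUE_homo => e; rewrite !ffunE; exact: le_uv.
move=> x; congr CLIQUE; apply/ffunP => e; by rewrite !ffunE.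
Qed.

Section CliqueCSP.
Variables (V E Y : finType) (t s : nat) (slot : V -> 'I_t -> E).
Variable sat : Y -> V -> {ffun E -> 'I_s} -> bool.

Definition view (x : {ffun E -> 'I_s}) (v : V) : {ffun 'I_t -> 'I_s} :=
  [ffun j => x (slot v j)].

Hypothesis sat_view : forall y v x x', view x v = view x' v -> sat y v x = sat y v x'.
Hypothesis unsat : forall y x, exists v, ~~ sat y v x.

Variables (n P : nat) (iota : V * {ffun 'I_t -> 'I_s} + 'I_P -> 'I_n).
Hypothesis iota_inj : injective iota.
Hypothesis two_le : 1 < #|V| + P.

(** FGLSS-style encoding: a vertex is a constraint with a local view. The [P] padding vertices
    enlarge the clique independently of the assignment. *)
Definition locate (x : {ffun E -> 'I_s}) (u : V + 'I_P) : 'I_n :=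
  match u with inl v => iota (inl (v, view x v)) | inr i => iota (inr i) end.

Lemma locate_inj x x' u u' : locate x u = locate x' u' -> u = u'.
Proof. by case: u u' => [v|i] [v'|i'] /= /iota_inj // [->]. Qed.

Lemma locate_view x x' v v' :
  locate x (inl v) = locate x' (inl v') -> view x v = view x' v'.
Proof. by move=> /iota_inj[]. Qed.

Definition assign_clique (x : {ffun E -> 'I_s}) : {set 'I_n} :=
  [set locate x u | u : V + 'I_P].

Definition good_vertices (y : Y) (x : {ffun E -> 'I_s}) : {set 'I_n} :=
  [set locate x u | u : V + 'I_P & if u is inl v then sat y v x else true].

Definition sat_graph (y : Y) : {ffun edge n -> bool} :=
  [ffun e : edge n => [exists x, val e \subset good_vertices y x]].

Lemma CLIQUE_assign x : @CLIQUE n (#|V| + P) (clique_graph (assign_clique x)).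
Proof.
apply/existsP; exists (assign_clique x); apply/andP; split.
  rewrite card_imset; last by move=> u u' /locate_inj.
  by rewrite card_sum card_ord.
by apply/forallP => e; rewrite ffunE implybb.
Qed.

Lemma edgeP (a b : 'I_n) : a != b -> exists e : edge n, val e = [set a; b].
Proof.
move=> ab; have h : #|[set a; b]| == 2 by rewrite cards2 ab.
by exists (exist (fun e : {set 'I_n} => #|e| == 2) _ h).
Qed.

(* A clique of this size has one vertex per constraint, and the assignments
   witnessing its edges glue to a single one satisfying every constraint. *)
Lemma CLIQUE_sat_graph y : ~~ @CLIQUE n (#|V| + P) (sat_graph y).
Proof.
apply/negP => /existsP[Q /andP[/eqP cQ /forallP clQ]].
have pairP a b : a \in Q -> b \in Q -> exists x,
    (a \in good_vertices y x) && (b \in good_vertices y x).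
  have dP a' b' : a' \in Q -> b' \in Q -> a' != b' -> exists x,
    (a' \in good_vertices y x) && (b' \in good_vertices y x).
    move=> aQ bQ /edgeP[e eE]; have /implyP := clQ e.
    rewrite ffunE eE subUset !sub1set aQ bQ => /(_ isT) /existsP[x].
    by rewrite subUset !sub1set => h; exists x.
  move=> aQ bQ; have [<-|] := eqVneq a b; last exact: dP.
  (* The diagonal case needs a neighbour of [a] in [Q], which [two_le] provides. *)
  have : 0 < #|Q :\ a| by move: two_le; rewrite -cQ (cardsD1 a) aQ.
  case/card_gt0P => c; rewrite !inE => /andP[ca cQ'].
  have [x /andP[_ ax]] := dP c a cQ' aQ ca; by exists x; rewrite ax.
pose goodu (x : {ffun E -> 'I_s}) (u : V + 'I_P) := if u is inl v then sat y v x else true.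
have goodP a x : a \in good_vertices y x -> exists2 u, goodu x u & a = locate x u.
  by move=> /imsetP[u]; rewrite inE => gu ->; exists u.
(* Pigeonhole: members of [Q] with the same constraint or padding index coincide, and [Q] has as
   many members as there are indices. *)
have surj u : exists x, (locate x u \in Q) && goodu x u.
  have [f fP] : exists f : 'I_n -> V + 'I_P, forall a, a \in Q ->
      exists x, goodu x (f a) /\ a = locate x (f a).
    have /fin_all_exists[f fP] : forall a : 'I_n, exists u' : V + 'I_P, a \in Q ->
        exists x, goodu x u' /\ a = locate x u'.
      move=> a; case aQ: (a \in Q); last by exists u.
      have [x /andP[/goodP[u' gu' ->] _]] := pairP a a aQ aQ.
      by exists u' => _; exists x.
    by exists f.
  have f_inj : {in Q &, injective f}.
    move=> a b aQ bQ fab.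
    have [x /andP[/goodP[u1 _ aE] /goodP[u2 _ bE]]] := pairP a b aQ bQ.
    have [x1 [_]] := fP a aQ; rewrite {1}aE => /locate_inj e1.
    have [x2 [_]] := fP b bQ; rewrite {1}bE => /locate_inj e2.
    by rewrite aE bE e1 e2 fab.
  have /setP/(_ u) : f @: Q = setT.
    apply/eqP; rewrite eqEcard subsetT cardsT card_in_imset // cQ.
    by rewrite card_sum card_ord leqnn.
  rewrite inE => /imsetP[a aQ ->]; have [x [gx aE]] := fP a aQ.
  by exists x; rewrite -aE aQ.
have /fin_all_exists[xs xsP] := surj.
have agree v v' j j' : slot v j = slot v' j' ->
    view (xs (inl v)) v j = view (xs (inl v')) v' j'.
  move=> ejj'; have /andP[vQ _] := xsP (inl v); have /andP[v'Q _] := xsP (inl v').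
  have [x /andP[/goodP[u1 _ e1] /goodP[u2 _ e2]]] := pairP _ _ vQ v'Q.
  move: (e1) (e2) => /locate_inj h1 /locate_inj h2; subst u1 u2.
  by rewrite (locate_view e1) (locate_view e2) !ffunE ejj'.
have [u0 _] : exists u : V + 'I_P, true.
  have : 0 < #|{: V + 'I_P}| by rewrite card_sum card_ord; lia.
  by case/card_gt0P => u _; exists u.
(* A variable that no constraint reads takes its value from the arbitrary [xs u0]. *)
pose x : {ffun E -> 'I_s} := [ffun e =>
  if [pick vj : V * 'I_t | slot vj.1 vj.2 == e] is Some vj
  then view (xs (inl vj.1)) vj.1 vj.2 else xs u0 e].
have [v /negP[]] := unsat y x.
have /andP[_ /=] := xsP (inl v); rewrite (sat_view _ (x' := x)) //.
apply/ffunP => j; rewrite [RHS]ffunE [RHS]ffunE; case: pickP => [[v' j'] /= /eqP e|].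
  exact: agree.
by move=> /(_ (v, j)); rewrite /= eqxx.
Qed.

(** Were both endpoints good for one assignment, the edge would be present. Bob says which endpoint
    is bad, hence the factor 2; this vertex fixes Alice's view of one constraint, which therefore
    fails on the whole rectangle. *)
Lemma sat_graph_edge (e : edge n) (mu : {set {ffun E -> 'I_s}} -> {set Y} -> nat) (r : nat) :
  rect_measure mu ->
  (forall v (A : {set {ffun E -> 'I_s}}) (B : {set Y}),
    {in A & B, forall x y, ~~ sat y v x} -> mu A B <= r) ->
  forall (A : {set {ffun E -> 'I_s}}) (B : {set Y}),
  {in A, forall x, val e \subset assign_clique x} ->
  {in B, forall y, ~~ sat_graph y e} -> mu A B <= r.*2.
Proof.
move=> mu_rect mu_sat A B eA eB.
have [->|[x0 x0A]] := set_0Vmem A; first by rewrite (rect_measure0l mu_rect).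
have /cards2P[a [b [ab eE]]] : #|val e| == 2 := valP e.
have bound c (B' : {set Y}) : c \in val e ->
    {in B', forall y, c \notin good_vertices y x0} -> mu A B' <= r.
  move=> ce cB'; have /subsetP/(_ c ce)/imsetP[u _ cE] := eA x0 x0A.
  case: u cE cB' => [v|i] cE cB'.
    apply: (mu_sat v) => x y xA yB'; apply: contra (cB' y yB') => sxy.
    have /subsetP/(_ c ce)/imsetP[u _ cE'] := eA x xA.
    move: (cE'); rewrite cE => /locate_inj h; subst u.
    apply/imsetP; exists (inl v) => //.
    by rewrite inE (sat_view _ (x' := x)) //; apply: locate_view; rewrite -cE cE'.
  rewrite (_ : B' = set0) ?(rect_measure0r mu_rect) //.
  apply/setP => y; rewrite inE; apply/negbTE/negP => /cB' /imsetP[]; exists (inr i) => //.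
  by rewrite inE.
apply: (@mu_splitr _ _ _ mu_rect _ _ _ (fun y => a \notin good_vertices y x0)).
  apply: (bound a); first by rewrite eE !inE eqxx.
  by move=> y; rewrite inE => /andP[].
apply: (bound b); first by rewrite eE !inE eqxx orbT.
move=> y; rewrite inE negbK => /andP[/eB + ay]; apply: contra => bY.
by rewrite ffunE; apply/existsP; exists x0; rewrite eE subUset !sub1set ay.
Qed.

Lemma sparse_depth_bound (C : circuit (edge n)) (w r : nat)
    (mu : {set {ffun E -> 'I_s}} -> {set Y} -> nat) :
  computes C (@CLIQUE n (#|V| + P)) -> 0 < w ->
  (forall k, k < size (gates C) ->
    exists2 beta : {ffun edge n -> bool},
      has_orientation (gate_fun C k) beta & #|touched beta| <= w) ->
  rect_measure mu ->
  (forall v (A : {set {ffun E -> 'I_s}}) (B : {set Y}),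
    {in A & B, forall x y, ~~ sat y v x} -> mu A B <= r) ->
  mu setT setT <= r.*2 * 2 ^ (6 * w * depth C).
Proof.
move=> CC w0 sparse mu_rect mu_sat; rewrite expnM.
apply: (@mu_gate _ C w r.*2 w0 sparse _ _ mu assign_clique sat_graph mu_rect _
  (output C) [ffun=> false] _ _ sat_graph).
- by move=> e A B; apply: sat_graph_edge.
- exact: output_lt.
- by have [h hm hE] := CLIQUE_orientation n (#|V| + P); exists h => // x; rewrite CC hE.
split=> //.
- by move=> x _; rewrite CC CLIQUE_assign.
- by move=> y _; rewrite CC CLIQUE_sat_graph.
- by move=> x y _ _ e; rewrite ffunE.
Qed.

End CliqueCSP.

(** * The rank gap of Tseitin equations *)

Section RankMeasure.
Local Open Scope ring_scope.
Variables (F : fieldType) (X Y : finType) (M : X -> Y -> F).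

(** Entries outside the rectangle are zeroed, not deleted, so that the pieces of a partition add up
    as matrices of one size. *)
Definition mask_mx (A : {set X}) (B : {set Y}) : 'M[F]_(#|X|, #|Y|) :=
  \matrix_(i, j) if (enum_val i \in A) && (enum_val j \in B)
                 then M (enum_val i) (enum_val j) else 0.

Definition rect_rank A B : nat := \rank (mask_mx A B).

Lemma rank_sum (I : finType) (D : {set I}) m n (N : I -> 'M[F]_(m, n)) :
  (\rank (\sum_(i in D) N i)%R <= \sum_(i in D) \rank (N i))%N.
Proof.
elim/big_ind2: _ => [|A k B l hA hB|//]; first by rewrite mxrank0.
by rewrite (leq_trans (mxrank_add _ _)) // leq_add.
Qed.

Lemma rect_rank_measure : rect_measure rect_rank.
Proof.
split.
- move=> B; rewrite /rect_rank (_ : mask_mx _ _ = 0) ?mxrank0 //.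
  by apply/matrixP => i j; rewrite !mxE inE.
- move=> A; rewrite /rect_rank (_ : mask_mx _ _ = 0) ?mxrank0 //.
  by apply/matrixP => i j; rewrite !mxE inE andbF.
- move=> J D h A B hD; rewrite /rect_rank.
  rewrite (_ : mask_mx A B = \sum_(k in D) mask_mx [set x in A | h x == k] B).
    exact: rank_sum.
  apply/matrixP => i j; rewrite summxE !mxE.
  have [iA|iA] := boolP (enum_val i \in A); last first.
    by rewrite big1 // => k _; rewrite !mxE inE (negbTE iA).
  rewrite (bigD1 (h (enum_val i))) ?hD //= big1 ?addr0 => [|k /andP[_ ki]].
    by rewrite !mxE inE iA eqxx.
  by rewrite !mxE inE iA eq_sym (negbTE ki).
- move=> J D h A B hD; rewrite /rect_rank.
  rewrite (_ : mask_mx A B = \sum_(k in D) mask_mx A [set x in B | h x == k]).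
    exact: rank_sum.
  apply/matrixP => i j; rewrite summxE !mxE.
  have [jB|jB] := boolP (enum_val j \in B); last first.
    by rewrite andbF big1 // => k _; rewrite !mxE inE (negbTE jB) andbF.
  rewrite (bigD1 (h (enum_val j))) ?hD //= big1 ?addr0 => [|k /andP[_ ki]].
    by rewrite !mxE inE jB eqxx.
  by rewrite !mxE inE jB eq_sym (negbTE ki) !andbF.
Qed.

(** [N] inverts [M] on the right up to [c], and a product has rank at most that of its first
    factor. *)
Lemma rect_rank_full (N : Y -> X -> F) (c : F) : c != 0 ->
  (forall x x', \sum_y M x y * N y x' = if x == x' then c else 0) ->
  rect_rank setT setT = #|X|.
Proof.
move=> c0 MN; apply/eqP; rewrite eqn_leq rank_leq_row /=.
have <- : \rank (c%:M : 'M[F]_(#|X|)) = #|X| by rewrite -scalemx1 mxrank_scale_nz ?mxrank1.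
apply: leq_trans (mxrankM_maxl _ (\matrix_(j < #|Y|, i < #|X|) N (enum_val j) (enum_val i))).
set P := _ *m _; have -> // : P = c%:M; apply/matrixP => i i'; rewrite !mxE.
under eq_bigr => j _ do rewrite !mxE !inE /=.
rewrite -(big_enum_val (fun y => M (enum_val i) y * N y (enum_val i'))) /=.
rewrite MN (inj_eq enum_val_inj).
by case: eqP.
Qed.

End RankMeasure.

Section RankUpper.
Local Open Scope ring_scope.
Variables (F : fieldType) (E Y K : finType) (s : nat).
Notation X := {ffun E -> 'I_s}.
Variables (M : X -> Y -> F) (T : K -> X -> Y -> F) (U : K -> {set E}) (D : {set K}).
Hypothesis T_local : forall k (x x' : X) y,
  (forall e, e \in U k -> x e = x' e) -> T k x y = T k x' y.

(** Each term sees [x] only on [U k], so its matrix factors through the [s ^ #|U k|] restrictions of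
    [x]. *)
Lemma rect_rank_le (A : {set X}) (B : {set Y}) :
  {in A & B, forall x y, M x y = \sum_(k in D) T k x y} ->
  (rect_rank M A B <= \sum_(k in D) s ^ #|U k|)%N.
Proof.
move=> ME.
have [->|[x0 x0A]] := set_0Vmem A; first by rewrite (rect_measure0l (rect_rank_measure M)).
rewrite /rect_rank (_ : mask_mx M A B = \sum_(k in D) mask_mx (T k) A B); last first.
  apply/matrixP => i j; rewrite summxE !mxE.
  under eq_bigr => k _ do rewrite mxE.
  case: ifP => [/andP[iA jB]|_]; last by rewrite big1.
  exact: ME.
apply: leq_trans (rank_sum _ _) _; apply: leq_sum => k _.
pose W := {ffun {e | e \in U k} -> 'I_s}.
have -> : (s ^ #|U k| = #|W|)%N by rewrite card_ffun card_ord card_sig.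
pose ext (u : W) : X := [ffun e => if insub e is Some e' then u e' else x0 e].
pose res (x : X) : W := [ffun e => x (val e)].
have Tres x y : T k (ext (res x)) y = T k x y.
  apply: T_local => e eU; rewrite ffunE insubT /= ffunE //.
rewrite (_ : mask_mx _ _ _ =
    (\matrix_(i < #|X|, l < #|W|)
       if (enum_val i \in A) && (res (enum_val i) == enum_val l) then 1 else 0) *m
    (\matrix_(l < #|W|, j < #|Y|)
       if enum_val j \in B then T k (ext (enum_val l)) (enum_val j) else 0)).
  exact: mulmx_max_rank.
apply/matrixP => i j; rewrite !mxE.
rewrite (bigD1 (enum_rank (res (enum_val i)))) //= big1 ?addr0 => [|l li].
  rewrite !mxE enum_rankK eqxx andbT Tres.
  case: ifP => [/andP[-> ->]|]; first by rewrite mul1r.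
  by case: (_ \in A) => /= [->|_]; rewrite ?mulr0 ?mul0r.
rewrite !mxE (_ : (res _ == _) = false) ?andbF ?mul0r //.
by apply: contraNF li => /eqP ->; rewrite enum_valK.
Qed.

End RankUpper.

Definition sign (b : bool) : rat := ((-1) ^+ b)%R.

Lemma sign_addb a b : sign (a (+) b) = (sign a * sign b)%R.
Proof. exact: signr_addb. Qed.

Lemma sign_sqr b : (sign b * sign b = 1)%R.
Proof. by rewrite -sign_addb addbb. Qed.

(** * Tseitin equations and the gap function *)

Section Tseitin.
Local Open Scope ring_scope.
Variables (V E : finType) (src dst : E -> V) (v0 : V) (J s : nat).
Hypothesis cardV : #|V| = J.*2.+1.
Implicit Types (A : {set V}) (z : {ffun E -> bool}).

Definition boundary A : {set E} := [set e | (src e \in A) (+) (dst e \in A)].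

Definition charge A : rat := sign (v0 \in A).

(* The equation at [v] holds iff [violation v z = 1]; only the one at [v0]
   has right-hand side [-1], which makes the system inconsistent. *)
Definition violation v z : rat :=
  charge [set v] * \prod_e (sign ((src e == v) && z e) * sign ((dst e == v) && z e)).

Definition chi (U : {set E}) z : rat := \prod_(e in U) sign (z e).

Lemma prod_pred1 (T : finType) (A : {set T}) (a : T) (b : bool) :
  \prod_(v in A) sign ((a == v) && b) = sign ((a \in A) && b).
Proof.
have [aA|aA] := boolP (a \in A).
  rewrite (bigD1 a) //= eqxx big1 ?mulr1 // => v /andP[_].
  by rewrite eq_sym => /negbTE ->.
rewrite big1 // => v vA; case: eqP => [av|//].
by rewrite av vA in aA.
Qed.

(** An edge inside [A] contributes its sign twice and cancels; only edges leaving [A] remain. *)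
Lemma prod_violation A z :
  \prod_(v in A) violation v z = charge A * chi (boundary A) z.
Proof.
rewrite big_split /=; congr (_ * _).
  rewrite /charge; have := prod_pred1 A v0 true; rewrite andbT => <-.
  by apply: eq_bigr => v _; rewrite inE andbT.
rewrite exchange_big /= /chi [RHS]big_mkcond /=; apply: eq_bigr => e _.
rewrite big_split /= !prod_pred1 !inE.
by case: (src e \in A); case: (dst e \in A); rewrite /= ?mulr1 ?mul1r ?sign_sqr.
Qed.

Lemma violationE v z : violation v z = 1 \/ violation v z = -1.
Proof.
have -> : violation v z = \prod_(u in [set v]) violation u z by rewrite big_set1.
rewrite prod_violation /charge /chi.
have -> : \prod_(e in boundary [set v]) sign (z e) =
    sign (\big[addb/false]_(e in boundary [set v]) z e).
  by elim/big_rec2: _ => [|e y1 y2 _ ->] //; rewrite sign_addb.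
by rewrite -sign_addb; case: (_ (+) _); [right|left].
Qed.

Lemma prod_violation_setT z : \prod_v violation v z = -1.
Proof.
have -> : \prod_v violation v z = \prod_(v in [set: V]) violation v z.
  by apply: eq_bigl => v; rewrite inE.
rewrite prod_violation /charge inE (_ : boundary _ = set0) ?mulr1; last first.
  by apply/setP => e; rewrite !inE.
by rewrite /chi big_set0 mulr1.
Qed.

Lemma exists_violation z : exists v, violation v z != 1.
Proof.
have [v hv|h] := pickP (fun v => violation v z != 1); first by exists v.
have := prod_violation_setT z.
by rewrite big1 // => v _; have /negbFE/eqP := h v.
Qed.

(** Up to sign, [chi setT] turns the term of [A] into the character of the complement of its
    boundary, which is the full character for the empty set. *)
Definition gap_fun z : rat :=
  chi setT z * \sum_(A : {set V} | (#|A| <= J)%N) \prod_(v in A) violation v z.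

Lemma chi_compl (U : {set E}) z : chi setT z * chi U z = chi (~: U) z.
Proof.
rewrite /chi !(big_mkcond (fun e => e \in _)) -big_split /=; apply: eq_bigr => e _.
by rewrite !inE; case: (e \in U); rewrite /= ?sign_sqr ?mulr1.
Qed.

(* Pairing [A] with [v |: A] cancels every term but the middle layer. *)
Lemma gap_fun_violated v z : violation v z != 1 ->
  gap_fun z = \sum_(A in [set A : {set V} | (v \notin A) && (#|A| == J)])
    charge A * chi (~: boundary A) z.
Proof.
have [->|vz _] := violationE v z; first by rewrite eqxx.
rewrite /gap_fun (bigID (fun A : {set V} => v \in A)) /= [X in _ * (X + _)]
  (reindex_onto (fun A : {set V} => v |: A) (fun A => A :\ v)) /=; last first.
  by move=> A /andP[_ vA]; rewrite setD1K.
have -> : \sum_(A : {set V} | ((#|v |: A| <= J)%N && (v \in v |: A)) && ((v |: A) :\ v == A))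
    \prod_(u in v |: A) violation u z =
    - \sum_(A : {set V} | (#|A| < J)%N && (v \notin A)) \prod_(u in A) violation u z.
  rewrite -sumrN; apply: eq_big => [A|A /andP[_ /eqP vA]].
    have [vA|vA] := boolP (v \in A).
      rewrite andbF; apply/negbTE; rewrite negb_and; apply/orP; right.
      by apply: contraTneq vA => <-; rewrite !inE eqxx.
    by rewrite cardsU1 vA setU11 setU1K // eqxx !andbT.
  have {}vA : v \notin A by rewrite -vA !inE eqxx.
  by rewrite big_setU1 //= vz mulN1r.
rewrite addrC [X in X - _](bigID (fun A : {set V} => #|A| == J)) /= -addrA.
rewrite [X in _ + (X - _)](_ : _ = \sum_(A : {set V} | (#|A| < J)%N && (v \notin A))
   \prod_(u in A) violation u z); last first.
  apply: eq_bigl => A; rewrite ltn_neqAle.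
  by case: (#|A| <= J)%N; case: (v \in A); case: (#|A| == J).
rewrite subrr addr0 mulr_sumr; apply: eq_big => [A|A _].
  by rewrite !inE; case: ltngtP; rewrite ?andbF ?andbT.
by rewrite prod_violation mulrCA chi_compl.
Qed.

Notation X := {ffun E -> 'I_s}.
Notation Y := {ffun E -> {ffun 'I_s -> bool}}.

Definition ev (x : X) (y : Y) : {ffun E -> bool} := [ffun e => y e (x e)].

(** The sign-reversing involution that makes character sums over Bob's inputs vanish. *)
Definition flip (e0 : E) (a : 'I_s) (y : Y) : Y :=
  [ffun e => [ffun c => y e c (+) ((e == e0) && (c == a))]].

Lemma flipK e0 a : involutive (flip e0 a).
Proof. by move=> y; apply/ffunP => e; apply/ffunP => c; rewrite !ffunE addbK. Qed.

Lemma sum_flip0 e0 a (g : Y -> rat) :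
  (forall y, g (flip e0 a y) = - g y) -> \sum_y g y = 0.
Proof.
move=> gN; have : \sum_y g y = - \sum_y g y.
  rewrite {1}(reindex (flip e0 a)) /=; last first.
    by exists (flip e0 a) => y _; apply: flipK.
  by rewrite -sumrN; apply: eq_bigr => y _.
by move=> /eqP; rewrite -addr_eq0 -mulr2n mulrn_eq0 /= => /eqP.
Qed.

Lemma chi_flip (U : {set E}) e0 a (x : X) y :
  chi U (ev x (flip e0 a y)) = sign ((e0 \in U) && (x e0 == a)) * chi U (ev x y).
Proof.
rewrite -prod_pred1 /chi -big_split /=; apply: eq_bigr => e _.
rewrite !ffunE sign_addb mulrC eq_sym; congr (sign _ * _).
by case: eqP => [->|].
Qed.

Lemma ev_flip e0 a (x : X) y : x e0 != a -> ev x (flip e0 a y) = ev x y.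
Proof.
move=> xa; apply/ffunP => e; rewrite !ffunE.
by case: eqP => [->|_]; rewrite ?(negbTE xa) addbF.
Qed.

Hypothesis boundary_neq0 : forall A, A != set0 -> A != setT -> boundary A != set0.

(** Off the diagonal, flipping an entry read by [x'] but not by [x] reverses the sign. On it, every
    nonempty [A] with [#|A| <= J] is proper, so it has a boundary edge and its character sums to
    zero. *)
Lemma gap_mx_inverse (x x' : X) :
  \sum_y gap_fun (ev x y) * chi setT (ev x' y) =
  if x == x' then #|{: Y}|%:R else 0.
Proof.
have [<-|xx'] := eqVneq x x'; last first.
  have [e0 xe0] : exists e, x e != x' e.
    apply/existsP; apply: contraNT xx' => /existsPn h.
    by apply/eqP/ffunP => e; apply/eqP/negbNE/h.
  apply: (@sum_flip0 e0 (x' e0)) => y; rewrite ev_flip // chi_flip inE eqxx /=.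
  by rewrite /sign expr1 mulN1r mulrN.
under eq_bigr => y _.
  rewrite /gap_fun mulrC mulrA (_ : chi setT _ * chi setT _ = 1); last first.
    by rewrite chi_compl /chi big1 // => e; rewrite !inE.
  rewrite mul1r; over.
rewrite exchange_big /= (bigD1 set0) ?cards0 //= [X in _ + X]big1 ?addr0.
  under eq_bigr => y _ do rewrite big_set0.
  by rewrite sumr_const.
move=> A /andP[AJ A0].
have AT : A != setT.
  by apply: contraTneq AJ => ->; rewrite cardsT cardV -ltnNge ltnS -addnn leq_addr.
have /set0Pn[e0 e0A] := boundary_neq0 A0 AT.
apply: (@sum_flip0 e0 (x e0)) => y.
by rewrite !prod_violation chi_flip e0A eqxx /= /sign expr1 mulN1r mulrN.
Qed.

Definition gap_rank (A : {set X}) (B : {set Y}) : nat :=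
  rect_rank (fun x y => gap_fun (ev x y)) A B.

Lemma gap_rank_measure : rect_measure gap_rank.
Proof. exact: rect_rank_measure. Qed.

Lemma gap_rank_full : gap_rank setT setT = (s ^ #|E|)%N.
Proof.
have c0 : #|{: Y}|%:R != 0 :> rat.
  rewrite pnatr_eq0 -lt0n; apply/card_gt0P.
  by exists [ffun=> [ffun=> false]].
by rewrite /gap_rank (rect_rank_full c0 gap_mx_inverse) card_ffun card_ord.
Qed.

(** At most [2 ^ #|V|] terms of the middle layer survive, and each ignores the at least [p] boundary
    edges of its set. *)
Lemma gap_rank_violated (p : nat) v (A : {set X}) (B : {set Y}) :
  (0 < s)%N -> (forall D : {set V}, #|D| = J -> (p <= #|boundary D|)%N) ->
  {in A & B, forall x y, ~~ (violation v (ev x y) == 1)} ->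
  (gap_rank A B <= 2 ^ #|V| * s ^ (#|E| - p))%N.
Proof.
move=> s_gt0 expand viol.
set D := [set D : {set V} | (v \notin D) && (#|D| == J)].
have := @rect_rank_le rat E Y {set V} s (fun x y => gap_fun (ev x y))
  (fun D x y => charge D * chi (~: boundary D) (ev x y)) (fun D => ~: boundary D) D _ A B _.
move=> /(_ _ _)/leq_trans; apply.
- move=> k x x' y eqx; congr (_ * _); apply: eq_bigr => e ek.
  by rewrite !ffunE eqx.
- by move=> x y xA yB; apply: gap_fun_violated (viol x y xA yB).
apply: (@leq_trans (\sum_(C in D) s ^ (#|E| - p))%N).
  apply: leq_sum => C; rewrite inE => /andP[_ /eqP CJ].
  rewrite leq_pexp2l // -[#|~: _|](addKn #|boundary C|) cardsC.
  by rewrite leq_sub2l // expand.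
rewrite sum_nat_const leq_mul2r; apply/orP; right.
rewrite -cardsT -card_powerset subset_leq_card //.
by apply/subsetP => C _; rewrite inE subsetT.
Qed.

End Tseitin.

(** * Bounded-degree graphs without small bisections *)

Section RandomPreimage.
Variable T : finType.
Implicit Types (A B : {set T}) (h : {perm T}).

(** Each transposition of a point of [A :\: B] with one of [B :\: A] brings [A] closer to [B]. *)
Lemma exists_perm_preimset A B : #|A| = #|B| -> exists h, A = h @^-1: B.
Proof.
elim: {A}#|A :\: B| {-2}A (erefl #|A :\: B|) => [|m IH] A.
  move=> /eqP; rewrite cards_eq0 setD_eq0 => sAB cAB; exists 1%g.
  have /eqP -> : A == B by rewrite eqEcard sAB cAB leqnn.
  by apply/setP => x; rewrite inE perm1.
move=> cAD cAB; have /card_gt0P[x] : (0 < #|A :\: B|)%N by rewrite cAD.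
rewrite inE => /andP[xB xA].
have cBD : #|B :\: A| = m.+1.
  by move: (cardsID A B) (cardsID B A); rewrite setIC; lia.
have /card_gt0P[y] : (0 < #|B :\: A|)%N by rewrite cBD.
rewrite inE => /andP[yA yB].
have [||h hE] := IH (tperm x y @^-1: A).
- suff -> : tperm x y @^-1: A :\: B = (A :\: B) :\ x.
    by apply/eqP; rewrite -eqSS -cAD (cardsD1 x (A :\: B)) !inE xA xB.
  apply/setP => u; rewrite !inE; case: tpermP => [->|->|/eqP ux /eqP uy].
  + by rewrite (negbTE yA) eqxx andbF.
  + by rewrite yB andbF.
  + by rewrite ux.
- by rewrite card_preimset //; apply: perm_inj.
exists (tperm x y * h)%g; apply/setP => u.
have /setP/(_ (tperm x y u)) := hE.
by rewrite !inE tpermK permM.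
Qed.

Lemma card_permT : #|{: {perm T}}| = #|T|`!.
Proof.
rewrite -[in RHS]cardsT -card_perm; apply: eq_card => h.
by rewrite [RHS]unfold_in /perm_on; apply/esym/subsetP => i _; rewrite inE.
Qed.

(** Translation in the symmetric group matches the fibres over sets of equal size, so the preimage
    of [A] under a random permutation is uniform among them. *)
Lemma card_preim_perm A B : #|A| = #|B| ->
  (#|[set h : {perm T} | h @^-1: A == B]| * 'C(#|T|, #|A|) = #|T|`!)%N.
Proof.
move=> cAB; pose N (C : {set T}) := #|[set h : {perm T} | h @^-1: A == C]|.
have N_le (C C' : {set T}) : #|C| = #|C'| -> N C <= N C'.
  move=> /esym/exists_perm_preimset[g C'E].
  rewrite /N -(card_imset (mem [set h : {perm T} | h @^-1: A == C]) (mulgI g)).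
  apply/subset_leq_card/subsetP => f /imsetP[h + ->{f}].
  rewrite !inE => /eqP hC; apply/eqP/setP => u.
  by rewrite C'E -hC !inE permM.
have {N_le}NE (C : {set T}) : #|C| == #|A| -> N C = N B.
  by move=> /eqP cC; apply/eqP; rewrite eqn_leq !N_le // -?cAB ?cC.
rewrite -/(N B) -card_draws mulnC -sum_nat_const.
under eq_bigr => C do rewrite inE => /NE <-.
rewrite -card_permT.
rewrite -[RHS]sum1_card [RHS](partition_big (fun h : {perm T} => h @^-1: A)
  (fun C => C \in [set C : {set T} | #|C| == #|A|])) /=.
  by apply: eq_bigr => C _; rewrite /N -sum1_card; apply: eq_bigl => h; rewrite inE.
by move=> h _; rewrite inE card_preimset //; apply: perm_inj.
Qed.

(** Union bound: each of the [#|F| * #|F|] pairs is hit with probability [1 / 'C(#|T|, k)]. *)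
Lemma exists_perm_avoiding (F : {set {set T}}) (k : nat) :
  {in F, forall A, #|A| = k} -> (#|F| * #|F| < 'C(#|T|, k))%N ->
  exists h, {in F, forall A, h @^-1: A \notin F}.
Proof.
move=> Fk cF.
case: (pickP (fun h => [forall A in F, h @^-1: A \notin F])) => [h /forall_inP|bad].
  by exists h.
have bound : #|T|`! <= \sum_(A in F) \sum_(B in F) #|[set h : {perm T} | h @^-1: A == B]|.
  rewrite -card_permT.
  rewrite -sum1_card.
  under [X in _ <= X]eq_bigr => A _.
    under eq_bigr => B _ do rewrite -sum1dep_card big_mkcond /=.
    rewrite exchange_big /=; over.
  rewrite exchange_big /=; apply: leq_sum => h _.
  have /negbT/forall_inPn[A AF /negbNE hAF] := bad h.
  rewrite (bigD1 A) //= (bigD1 (h @^-1: A)) //= eqxx.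
  by rewrite -addnA leq_addr.
have := leq_mul bound (leqnn 'C(#|T|, k)).
rewrite big_distrl /=.
under eq_bigr => A AF.
  rewrite big_distrl /=.
  under eq_bigr => B BF do rewrite -(Fk A AF) card_preim_perm ?(Fk A AF) ?(Fk B BF) //.
  rewrite sum_nat_const; over.
rewrite sum_nat_const mulnA mulnC leq_mul2r leqNgt cF orbF.
by rewrite eqn0Ngt fact_gt0.
Qed.

End RandomPreimage.

(** * Binomial and exponential estimates *)

Lemma central_bin_ge J : 2 ^ J <= 'C(J.*2.+1, J).
Proof.
elim: J => // J IH; rewrite doubleS binS (@leq_trans 'C(J.*2.+2, J.+1)) ?leq_addr //.
rewrite binS expnS mul2n -addnn leq_add //.
have -> : 'C(J.*2.+1, J.+1) = 'C(J.*2.+1, J) => //.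
rewrite -(@bin_sub J.*2.+1 J); last lia.
by congr binomial; lia.
Qed.

(** Bernoulli's inequality [(1 - 1/(r+1)) ^ k >= 1 - k/(r+1)], cleared of denominators. *)
Lemma bernoulli_pred r k : k <= r.+1 -> (r.+1 - k) * r.+1 ^ k <= r ^ k * r.+1.
Proof.
elim: k => [|k IH] ltk; first by rewrite subn0 !expn0 muln1 mul1n.
rewrite !expnS -mulnA; apply: leq_trans (leq_mul (leqnn r) (IH (ltnW ltk))).
by rewrite !mulnA leq_mul2r; apply/orP; right; rewrite subSS; nia.
Qed.

Lemma expS_le_double r k q : k.*2 <= r.+1 -> r.+1 ^ (k * q) <= 2 ^ q * r ^ (k * q).
Proof.
move=> k2; case: q => [|q]; first by rewrite muln0.
rewrite !(expnM _ k) -expnMn leq_exp2r // -(@leq_pmul2r r.+1) //.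
rewrite -mulnA; apply: (leq_trans _ (leq_mul (leqnn 2) (bernoulli_pred _))); last by lia.
by rewrite mulnC mulnA leq_mul2r; apply/orP; right; lia.
Qed.

(** Weighting [D] by [31 ^ (#|T| - #|D|)] gives total weight [32 ^ #|T|], while each small set
    weighs at least [31 ^ (79 * p).+1]. *)
Lemma card_small_sets (T : finType) (p : nat) : #|T| = (80 * p).+1 -> 0 < p ->
  #|[set D : {set T} | #|D| < p]| <= 2 ^ (10 * p).
Proof.
move=> cT p_gt0; set L := #|_|.
have sum_all : \sum_(D : {set T}) 31 ^ (#|T| - #|D|) = 32 ^ #|T|.
  have <- : \prod_(i : T) (1 + 31) = 32 ^ #|T| by rewrite prod_nat_const.
  rewrite bigA_distr; apply: eq_bigr => D _.
  rewrite (bigID (mem D)) /= big1 ?mul1n => [|i ->//].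
  rewrite (eq_bigr (fun=> 31)) => [|i /negbTE ->//].
  rewrite prod_nat_const -(cardsC D) addKn; congr (31 ^ _).
  by apply: eq_card => i; rewrite !inE.
have hL : L * 31 ^ (79 * p).+1 <= 32 ^ (80 * p).+1.
  rewrite -cT -sum_all (bigID (fun D : {set T} => #|D| < p)) /=.
  rewrite (leq_trans _ (leq_addr _ _)) //.
  rewrite /L -sum1dep_card big_distrl /=.
  by apply: leq_sum => D Dp; rewrite mul1n leq_exp2l // cT; lia.
(* [32 ^ 16 <= 2 * 31 ^ 16], raised to the power [5 * p]. *)
have h80 : 32 ^ (80 * p) <= 2 ^ (5 * p) * 31 ^ (80 * p).
  by rewrite -[80]/(16 * 5)%N -mulnA; apply: (@expS_le_double 31 16 (5 * p)).
rewrite -(@leq_pmul2r (31 ^ (79 * p).+1)) ?expn_gt0 //.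
apply: (leq_trans hL); rewrite expnS.
apply: (@leq_trans (32 * (2 ^ (5 * p) * 31 ^ (80 * p)))); first by rewrite leq_mul2l h80 orbT.
have -> : 80 * p = p.-1 + (79 * p).+1 by lia.
have -> : 10 * p = 5 * p + 5 * p by lia.
rewrite (expnD 31 p.-1) (expnD 2 (5 * p)) mulnCA -!mulnA leq_mul2l; apply/orP; right.
rewrite mulnA leq_mul2r; apply/orP; right.
rewrite [X in _ <= X]expnM -{2}(prednK p_gt0) expnS leq_mul2l /=.
by case: (p.-1) => // q; rewrite leq_exp2r.
Qed.

(** * A bisection expander made of two cycles *)

Section CycleExpander.
Variable p : nat.
Hypothesis p_gt0 : 0 < p.
Let m := 80 * p.
Notation V := 'I_m.+1.

Definition cycle_cut (A : {set V}) : {set V} :=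
  [set v | (v \in A) (+) (ordS v \in A)].

(** Walking along the cycle from [ord0], each cut bit tells whether membership changes. *)
Lemma cycle_cut_inj (A B : {set V}) :
  cycle_cut A = cycle_cut B -> (ord0 \in A) = (ord0 \in B) -> A = B.
Proof.
move=> /setP cAB AB0; apply/setP => -[i lti].
elim: i lti => [|i IH] lti; first by rewrite (_ : Ordinal lti = ord0) //; apply: val_inj.
have := cAB (Ordinal (ltnW lti)); rewrite !inE IH.
rewrite (_ : ordS _ = Ordinal lti); last by apply: val_inj; rewrite /= modn_small.
by case: (_ \in B); case: (Ordinal lti \in A); case: (Ordinal lti \in B).
Qed.

Lemma cycle_cut_neq0 (A : {set V}) : A != set0 -> A != setT -> cycle_cut A != set0.
Proof.
move=> A0 AT; apply/eqP => cA0.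
have cs0 : cycle_cut set0 = set0 by apply/setP => v; rewrite !inE.
have csT : cycle_cut setT = set0 by apply/setP => v; rewrite !inE.
case A_0: (ord0 \in A).
  by move/eqP: AT; apply; apply: cycle_cut_inj; rewrite ?cA0 ?csT // inE.
by move/eqP: A0; apply; apply: cycle_cut_inj; rewrite ?cA0 ?cs0 // inE.
Qed.

Definition few_arcs : {set {set V}} :=
  [set A : {set V} | (#|A| == 40 * p) && (#|cycle_cut A| < p)].

Lemma card_few_arcs : #|few_arcs| <= 2 ^ (10 * p).+1.
Proof.
pose f (A : {set V}) := (ord0 \in A, cycle_cut A).
have f_inj : injective f by move=> A B [AB0 cAB]; apply: cycle_cut_inj.
rewrite -(card_imset _ f_inj) expnS.
apply: (@leq_trans #|setX [set: bool] [set D : {set V} | #|D| < p]|).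
  apply/subset_leq_card/subsetP => _ /imsetP[A + ->].
  by rewrite !inE => /andP[].
rewrite cardsX cardsT card_bool leq_mul2l /=.
by apply: card_small_sets => //; rewrite card_ord.
Qed.

(** Sets of this size with few arcs are so rare that some permutation pulls none of them back to
    another one. *)
Lemma exists_expanding_perm : exists h : {perm V}, forall A : {set V},
  #|A| = 40 * p -> p <= #|cycle_cut A| \/ p <= #|cycle_cut (h @^-1: A)|.
Proof.
have [|| h hP] := @exists_perm_avoiding V few_arcs (40 * p).
- by move=> A; rewrite inE => /andP[/eqP].
(* [2 ^ (20 p + 2) < 2 ^ (40 p) <= 'C(80 p + 1, 40 p)] *)
- rewrite card_ord; apply: (leq_ltn_trans (leq_mul card_few_arcs card_few_arcs)).
  rewrite /m (_ : 80 * p = (40 * p).*2); last by lia.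
  apply: leq_trans (central_bin_ge _).
  by rewrite -expnD ltn_exp2l //; lia.
exists h => A cA; have [|ltA] := leqP p #|cycle_cut A|; first by left.
right; have : A \in few_arcs by rewrite inE cA eqxx.
move=> /hP; rewrite inE card_preimset ?cA ?eqxx -?leqNgt //; exact: perm_inj.
Qed.

Variable h : {perm V}.
Hypothesis h_expand : forall A : {set V},
  #|A| = 40 * p -> p <= #|cycle_cut A| \/ p <= #|cycle_cut (h @^-1: A)|.

(** The flag selects the plain cycle or its copy relabelled by [h]; [A] cuts the copy where
    [h @^-1: A] cuts the plain cycle. *)
Definition cyc_src (e : bool * V) : V := if e.1 then h e.2 else e.2.
Definition cyc_dst (e : bool * V) : V := if e.1 then h (ordS e.2) else ordS e.2.

Lemma cycle_cut_boundary (A : {set V}) :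
  [set (false, v) | v in cycle_cut A] \subset boundary cyc_src cyc_dst A.
Proof. by apply/subsetP => _ /imsetP[v + ->]; rewrite !inE. Qed.

Lemma boundary_expand (A : {set V}) : #|A| = 40 * p ->
  p <= #|boundary cyc_src cyc_dst A|.
Proof.
move=> /h_expand[|] /leq_trans; apply.
  rewrite -(@card_imset _ _ (fun v => (false, v))) => [|u v []//].
  exact/subset_leq_card/cycle_cut_boundary.
rewrite -(@card_imset _ _ (fun v => (true, v))) => [|u v []//].
by apply/subset_leq_card/subsetP => _ /imsetP[v + ->]; rewrite !inE.
Qed.

Lemma boundary_connected (A : {set V}) : A != set0 -> A != setT ->
  boundary cyc_src cyc_dst A != set0.
Proof.
move=> A0 AT; have /set0Pn[v vA] := cycle_cut_neq0 A0 AT.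
apply/set0Pn; exists (false, v); apply: (subsetP (cycle_cut_boundary A)).
exact: imset_f.
Qed.

(** Each vertex meets two edges of each cycle, so a local view takes only [s ^ 4] values. *)
Definition cyc_slot (u : V) (j : 'I_4) : bool * V :=
  match val j with
  | 0 => (false, u)
  | 1 => (false, ord_pred u)
  | 2 => (true, h^-1%g u)
  | _ => (true, ord_pred (h^-1%g u))
  end.

Lemma cyc_slotP u e : (cyc_src e == u) || (cyc_dst e == u) -> exists j, cyc_slot u j = e.
Proof.
case: e => [[] v] /orP[] /eqP <-; rewrite /cyc_src /cyc_dst /cyc_slot /=.
- by exists (inord 2); rewrite inordK // permK.
- by exists (inord 3); rewrite inordK //= permK ordSK.
- by exists (inord 0); rewrite inordK.
- by exists (inord 1); rewrite inordK //= ordSK.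
Qed.

End CycleExpander.

(** * The lower bound *)

Lemma violation_local (V E : finType) (src dst : E -> V) v0 v (z z' : {ffun E -> bool}) :
  (forall e, (src e == v) || (dst e == v) -> z e = z' e) ->
  violation src dst v0 v z = violation src dst v0 v z'.
Proof.
move=> zz'; congr (_ * _)%R; apply: eq_bigr => e _.
have := zz' e; case: (src e == v); case: (dst e == v) => //= -> //.
Qed.

(* The [p] boundary edges missing from each character cost a factor [s ^ p] in
   rank, and [s = 2 ^ 100] outweighs the at most [2 ^ (80 p + 1)] characters. *)
Lemma sparse_depth_ge (s p n : nat) (C : circuit (edge n)) (w : nat) :
  s = 2 ^ 100 -> 0 < p -> (80 * p).+1 * s ^ 4 <= n./2 ->
  computes C (@CLIQUE n n./2) -> 0 < w ->
  (forall k, k < size (gates C) ->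
    exists2 beta : {ffun edge n -> bool},
      has_orientation (gate_fun C k) beta & #|touched beta| <= w) ->
  p <= depth C * w.
Proof.
move=> sE p_gt0 sn CC w_gt0 sparse.
have s_gt0 : 0 < s by rewrite sE expn_gt0.
have [h h_expand] := exists_expanding_perm p_gt0.
pose V := 'I_(80 * p).+1; pose E := (bool * V)%type.
pose P := n./2 - (80 * p).+1.
have V_le : (80 * p).+1 <= n./2.
  by apply: leq_trans sn; rewrite leq_pmulr // expn_gt0 s_gt0.
have PE : #|{: V}| + P = n./2 by rewrite card_ord subnKC.
have [iota iota_inj] : exists iota : V * {ffun 'I_4 -> 'I_s} + 'I_P -> 'I_n,
    injective iota.
  (* Constraint vertices take at most one half of the [n] vertices, padding at most the other. *)
  have le_n : #|{: V * {ffun 'I_4 -> 'I_s} + 'I_P}| <= n.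
    rewrite card_sum card_prod card_ffun !card_ord.
    apply: (@leq_trans (n./2 + n./2)); first by rewrite leq_add // leq_subr.
    by rewrite addnn -[X in _ <= X]odd_double_half leq_addl.
  exists (fun u => widen_ord le_n (enum_rank u)) => u u' /(congr1 val) /= e.
  by apply: enum_rank_inj; apply: val_inj.
pose sat (y : {ffun E -> {ffun 'I_s -> bool}}) (v : V) (x : {ffun E -> 'I_s}) :=
  violation (cyc_src h) (cyc_dst h) ord0 v (ev x y) == 1%R.
have sat_view y v x x' : view (cyc_slot h) x v = view (cyc_slot h) x' v ->
    sat y v x = sat y v x'.
  move=> /ffunP eqx; rewrite /sat (@violation_local _ _ _ _ _ _ _ (ev x' y)) // => e.
  by move=> /cyc_slotP[j <-]; have := eqx j; rewrite !ffunE => ->.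
have unsat y x : exists v, ~~ sat y v x := exists_violation _ _ _ (ev x y).
have cardV : #|{: V}| = (40 * p).*2.+1 by rewrite card_ord; lia.
have := @sparse_depth_bound V E _ 4 s (cyc_slot h) sat sat_view unsat n P iota iota_inj
  _ C w (2 ^ (80 * p).+1 * s ^ (#|{: E}| - p))
  (gap_rank (cyc_src h) (cyc_dst h) ord0 (40 * p) (s := s)) _ w_gt0 sparse
  (@gap_rank_measure _ _ _ _ _ _ _) _.
rewrite PE (@gap_rank_full _ _ _ _ _ _ s cardV (@boundary_connected p h)).
move=> /(_ _ CC) hb.
have {}hb : s ^ #|{: E}| <= (2 ^ (80 * p).+1 * s ^ (#|{: E}| - p)).*2 * 2 ^ (6 * w * depth C).
  apply: hb; first by apply: leq_trans V_le; rewrite ltnS muln_gt0.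
  move=> v A B viol; rewrite -[X in 2 ^ X](card_ord).
  exact: (gap_rank_violated s_gt0 (boundary_expand h_expand) viol).
have pE : p <= #|{: E}| by rewrite card_prod card_bool card_ord; lia.
move: hb; rewrite -{1}(subnK pE) expnD -muln2.
rewrite -!mulnA [X in _ <= X -> _]mulnCA leq_pmul2l ?expn_gt0 ?s_gt0 //.
(* What remains is [100 p <= 80 p + 2 + 6 w d], where [p > 0] absorbs the 2. *)
rewrite sE -expnM -expnS -expnD leq_exp2l //.
by lia.
Qed.

(** A bound linear in [n], stronger than the target by a logarithm. *)
Lemma sparse_clique_linear : exists2 K, 0 < K &
  forall n (C : circuit (edge n)) (w : nat), K <= n ->
    computes C (@CLIQUE n n./2) -> 0 < w ->
    (forall k, k < size (gates C) ->
      exists2 beta : {ffun edge n -> bool},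
        has_orientation (gate_fun C k) beta & #|touched beta| <= w) ->
    n <= K.*2 * (depth C * w).
Proof.
(* [s] stays opaque so that the unary number [2 ^ 100] is never computed. *)
have [s sE] : exists s, s = 2 ^ 100 by exists (2 ^ 100).
have s_gt0 : 0 < s ^ 4 by rewrite sE !expn_gt0.
(* [162 = 2 * 81]: [(80 * p).+1 <= 81 * p], and the clique size is half of [n]. *)
exists (162 * s ^ 4); first by rewrite muln_gt0 s_gt0.
move=> n C w Kn CC w_gt0 sparse; set K := 162 * s ^ 4.
have K_gt0 : 0 < K by rewrite muln_gt0 s_gt0.
have p_gt0 : 0 < n %/ K by rewrite divn_gt0.
have := @sparse_depth_ge s (n %/ K) n C w sE p_gt0 _ CC w_gt0 sparse.
set p := n %/ K in p_gt0 *.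
have pK : p * K <= n := leq_trunc_div n K.
have ltK : n < p.+1 * K by rewrite ltn_ceil.
(* As [p >= 1], [n < (p + 1) * K <= 2 * p * K]. *)
move=> /(_ _) hp; apply: (@leq_trans (K.*2 * p)).
  apply: (leq_trans (ltnW ltK)); rewrite mulnC -muln2 -mulnA leq_mul2l; lia.
rewrite leq_mul2l hp ?orbT //.
rewrite geq_half_double; apply: leq_trans pK.
by rewrite -muln2 mulnAC /K mulnA leq_mul2r; apply/orP; right; lia.
Qed.

(* Passage to the asymptotic bound over the reals *)
From mathcomp Require Import all_classical all_reals all_analysis.

Import Order.TTheory GRing.Theory Num.Theory.
Import numFieldNormedType.Exports.

Local Open Scope classical_set_scope.
Local Open Scope ring_scope.

Theorem theorem5 (R : realType) (C : forall n : nat, circuit (edge n))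
    (d w : nat -> nat)
    (hdepth : forall n, depth (C n) = d n)
    (hC : forall n, computes (C n) (@CLIQUE n n./2))
    (hw0 : forall n, (0 < w n)%N)
    (hw : forall n k, (k < size (gates (C n)))%N ->
      exists2 beta : {ffun edge n -> bool},
        has_orientation (gate_fun (C n) k) beta &
        (#|touched beta| <= w n)%N) :
  (fun n => (d n * w n)%:R : R) \is 'Omega_\oo (fun n => n%:R / ln n%:R : R).
Proof.
have [K K_gt0 dwK] := sparse_clique_linear.
have ln2 : 0 < ln (2 : R) by rewrite ln_gt0 // ltr1n.
(* For [n >= 2], [ln n >= ln 2], so [n / ln n <= n / ln 2] and the linear bound suffices. *)
rewrite qualifE; apply/asboolP; exists (ln 2 / K.*2%:R).
  by rewrite divr_gt0 // ltr0n double_gt0.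
exists (maxn K 2) => // n /=; rewrite geq_max => /andP[Kn n2].
have lnn : ln 2 <= ln (n%:R : R).
  by rewrite ler_ln ?posrE ?ltr0n ?ler_nat // (leq_trans _ n2).
have lnn0 : 0 < ln (n%:R : R) := lt_le_trans ln2 lnn.
have hn : (n%:R : R) <= K.*2%:R * (d n * w n)%:R.
  by rewrite -natrM ler_nat -hdepth; apply: dwK (hw n).
have g0 : 0 <= n%:R / ln (n%:R : R) by rewrite divr_ge0 ?ler0n ?(ltW lnn0).
rewrite normr_nat (ger0_norm g0).
rewrite mulrAC ler_pdivrMr ?ltr0n ?double_gt0 // mulrA ler_pdivrMr //.
rewrite [ln 2 * _]mulrC; apply: ler_pM; rewrite ?ler0n ?(ltW ln2) //.
by rewrite mulrC.
Qed.
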